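(* The reduced tight span $\mathbf{F}(\mathbb{S}^1)=\{f:[0,\pi]\to\mathbb{R}\ 1\text{-Lipschitz}:0\le f\le\pi,\ f(0)+f(\pi)=\pi\}$, endowed with the sup norm, is homeomorphic to the Hilbert cube $\mathfrak{H}=\prod_{k=1}^\infty\left[-\frac1k,\frac1k\right]\subseteq\ell^2$.
   Context: $\ell^2$ is the Hilbert space of square-summable real sequences; $\mathfrak{H}$ carries the subspace topology. *)

(* Defs.v *)
From Stdlib Require Import Reals.
From Coquelicot Require Import Coquelicot.
Open Scope R_scope.

Definition I0pi : Type := { x : R | 0 <= x <= PI }.

Definition inF (f : I0pi -> R) : Prop :=
  (forall x y : I0pi, Rabs (f x - f y) <= Rabs (proj1_sig x - proj1_sig y)) /\
  (forall x : I0pi, 0 <= f x <= PI) /\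
  (forall x y : I0pi, proj1_sig x = 0 -> proj1_sig y = PI -> f x + f y = PI).

Definition Fspace : Type := { f : I0pi -> R | inF f }.

Definition dF (f g : Fspace) : R :=
  real (Lub_Rbar (fun r => exists x : I0pi,
          r = Rabs (proj1_sig f x - proj1_sig g x))).

(* Hilbert cube: sequences x with |x_k| <= 1/k for k >= 1;
   coordinate k is stored at index k-1, i.e. |x n| <= 1/(n+1). *)
Definition inH (x : nat -> R) : Prop :=
  forall n : nat, Rabs (x n) <= / INR (S n).

Definition Hcube : Type := { x : nat -> R | inH x }.

Definition dH (x y : Hcube) : R :=
  sqrt (Series (fun n => (proj1_sig x n - proj1_sig y n) ^ 2)).

Definition metric_continuous {X Y : Type} (dX : X -> X -> R) (dY : Y -> Y -> R)
  (h : X -> Y) : Prop :=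
  forall (a : X) (eps : R), 0 < eps ->
    exists delta : R, 0 < delta /\
      forall b : X, dX a b < delta -> dY (h a) (h b) < eps.

Definition homeomorphic {X Y : Type} (dX : X -> X -> R) (dY : Y -> Y -> R) : Prop :=
  exists (phi : X -> Y) (psi : Y -> X),
    (forall x, psi (phi x) = x) /\ (forall y, phi (psi y) = y) /\
    metric_continuous dX dY phi /\ metric_continuous dY dX psi.

(* Main.v *)
Require Import Defs.
From Stdlib Require Import Reals Lra Lia PArith FunctionalExtensionality ProofIrrelevance.
From Coquelicot Require Import Coquelicot.
Open Scope R_scope.

(** An element of [F(S^1)] is determined by its derivative, an arbitrary element of the
    unit ball of [L^oo[0, pi]], hence by its mean slopes on the dyadic subintervals: a
    labelling [m] of the binary tree by [[-1, 1]] in which every label is the average of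
    the labels of the two children.  Averaging [[-1, 1]^2 -> [-1, 1]] has degenerate
    fibres over [-1] and [1], but for every [w > 0] it is [w]-close to the first component
    of a homeomorphism ([bend], [residue]) of [[-1, 1]^2], and [bend] is 2-Lipschitz for
    every [w].  Let [w] decay like [4^-k] with the depth [k].  Then applying [bend] from
    depth [n] upwards to [m] converges as [n -> oo] to a labelling in which every label is
    the [bend] of the labels of its children, and averaging upwards in that labelling
    recovers [m].  A labelling consistent with [bend] amounts to freely chosen numbers in
    [[-1, 1]]: the label of the root and the residue at each node. *)

(** * Truncation and a piecewise defined homeomorphism of the square *)

(* For [c >= 0] this is the truncation of [x] to [[-c, c]]. *)
Definition clamp (c x : R) : R := (Rabs (x + c) - Rabs (x - c)) / 2.

Lemma clamp_id (c x : R) : Rabs x <= c -> clamp c x = x.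
Proof.
  intros H; apply Rabs_le_between in H; unfold clamp.
  rewrite (Rabs_pos_eq (x + c)), (Rabs_left1 (x - c)); lra.
Qed.

Lemma clamp_ge (c x : R) : 0 <= c <= x -> clamp c x = c.
Proof. intros H; unfold clamp; rewrite !Rabs_pos_eq; lra. Qed.

Lemma clamp_le (c x : R) : 0 <= c <= - x -> clamp c x = - c.
Proof. intros H; unfold clamp; rewrite !Rabs_left1; lra. Qed.

Lemma clamp_mid (c x : R) : - c <= x <= c -> clamp c x = x.
Proof. intros H; apply clamp_id, Rabs_le, H. Qed.

Ltac flat t :=
  lazymatch t with
  | context [Rabs _] => fail
  | context [clamp _ _] => fail
  | _ => idtac
  end.

(* Innermost occurrences first, with impossible branches discarded on the way: splitting
   all absolute values before calling [lra] is exponential. *)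
Ltac split_flat :=
  repeat match goal with H : context [Rabs _] |- _ => revert H end;
  repeat (match goal with
  | |- context [Rabs ?x] => flat x;
      destruct (Rle_dec 0 x);
        [rewrite !(Rabs_pos_eq x) by lra | rewrite !(Rabs_left1 x) by lra]
  | |- context [clamp ?c ?x] => flat c; flat x;
      destruct (Rle_dec c x); [rewrite !(clamp_ge c x) by lra|
      destruct (Rle_dec x (- c)); [rewrite !(clamp_le c x) by lra|
      rewrite !(clamp_mid c x) by lra]]
  end; try (exfalso; lra)); intros; lra.

Lemma clamp_opp (c x : R) : clamp c (- x) = - clamp c x.
Proof.
  unfold clamp.
  replace (- x + c) with (- (x - c)) by ring.
  replace (- x - c) with (- (x + c)) by ring.
  rewrite !Rabs_Ropp; lra.
Qed.

(** For a nonnegative level, truncation is a lattice expression in [c], [- c] and [x], hence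
    nonexpansive for the sup norm in both arguments jointly. *)
Lemma clamp_lipschitz (c c' x x' r : R) :
  0 <= c -> 0 <= c' -> Rabs (c - c') <= r -> Rabs (x - x') <= r ->
  Rabs (clamp c x - clamp c' x') <= r.
Proof. intros Hc Hc' H1 H2; split_flat. Qed.

(** Positive homogeneity; it turns the truncation of [v] in [unfold_diff] into a truncation of
    [d * v], free of divisions. *)
Lemma clamp_scale (k c x : R) : 0 < k -> k * clamp (c / k) x = clamp c (k * x).
Proof.
  intros Hk; unfold clamp.
  replace (k * x + c) with (k * (x + c / k)) by (field; lra).
  replace (k * x - c) with (k * (x - c / k)) by (field; lra).
  rewrite !Rabs_mult, (Rabs_pos_eq k) by lra; field.
Qed.

(** For [0 <= d <= 1], the signed amount by which [m] overshoots the core [[-(1 - d), 1 - d]]. *)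
Definition excess (d m : R) : R := m - clamp (1 - d) m.

(* With [m = (x + y) / 2] and [h = (x - y) / 2] the square becomes the diamond
   [Rabs m + Rabs h <= 1].  Where [Rabs m <= 1 - d], the fibre of [m] is rescaled to
   [[-1, 1]].  Each of the two remaining corners, divided by [d], is the triangle
   [Rabs h <= 1 - a], mapped onto a rectangle by the piecewise linear map
   [(a, h) -> (a + min a (Rabs h), h + clamp a h)], the identity on the edge [a = 0]. *)
Definition fold_mean (d m h : R) : R := m + clamp (Rabs h) (excess d m).
Definition fold_pos (d m h : R) : R :=
  (h + clamp (Rabs (excess d m)) h) / (1 - Rabs m + Rabs (excess d m)).
Definition unfold_mean (d u v : R) : R := u - clamp (d * Rabs v) (excess d u) / 2.
Definition unfold_diff (d u v : R) : R :=
  (1 - Rabs (unfold_mean d u v) + Rabs (excess d (unfold_mean d u v)))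
  * (v - clamp (Rabs (excess d u) / d) v / 2).

Lemma excess_opp (d m : R) : excess d (- m) = - excess d m.
Proof. unfold excess; rewrite clamp_opp; ring. Qed.

Lemma excess_core (d m : R) : Rabs m <= 1 - d -> excess d m = 0.
Proof. intros H; unfold excess; rewrite clamp_id; lra. Qed.

Lemma excess_shell (d m : R) : d <= 1 -> 1 - d <= m -> excess d m = m - (1 - d).
Proof. intros H H'; unfold excess; rewrite clamp_ge; lra. Qed.

Lemma fold_mean_opp (d m h : R) : fold_mean d (- m) h = - fold_mean d m h.
Proof. unfold fold_mean; rewrite excess_opp, clamp_opp; ring. Qed.

Lemma fold_pos_opp (d m h : R) : fold_pos d (- m) h = fold_pos d m h.
Proof. unfold fold_pos; now rewrite excess_opp, !Rabs_Ropp. Qed.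

Lemma unfold_mean_opp (d u v : R) : unfold_mean d (- u) v = - unfold_mean d u v.
Proof. unfold unfold_mean; rewrite excess_opp, clamp_opp; field. Qed.

Lemma unfold_diff_opp (d u v : R) : unfold_diff d (- u) v = unfold_diff d u v.
Proof.
  unfold unfold_diff; now rewrite unfold_mean_opp, !excess_opp, !Rabs_Ropp.
Qed.

Lemma fold_mean_core (d m h : R) : Rabs m <= 1 - d -> fold_mean d m h = m.
Proof.
  intros H; unfold fold_mean; rewrite excess_core, clamp_id by (try split_flat); ring.
Qed.

Lemma fold_pos_core (d m h : R) :
  Rabs m <= 1 - d -> fold_pos d m h = h / (1 - Rabs m).
Proof.
  intros H; unfold fold_pos; rewrite excess_core by lra.
  rewrite Rabs_R0; replace (clamp 0 h) with 0.
  - now rewrite !Rplus_0_r.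
  - unfold clamp; rewrite Rplus_0_r, Rminus_0_r; lra.
Qed.

Lemma unfold_mean_core (d u v : R) : 0 < d ->
  Rabs u <= 1 - d -> unfold_mean d u v = u.
Proof.
  intros Hd H; unfold unfold_mean; rewrite excess_core by lra.
  rewrite clamp_id; [lra|]. rewrite Rabs_R0.
  apply Rmult_le_pos; [lra|apply Rabs_pos].
Qed.

Lemma unfold_diff_core (d u v : R) : 0 < d ->
  Rabs u <= 1 - d -> unfold_diff d u v = (1 - Rabs u) * v.
Proof.
  intros Hd H; unfold unfold_diff; rewrite unfold_mean_core, excess_core by lra.
  rewrite Rabs_R0; replace (clamp (0 / d) v) with 0.
  - field.
  - unfold clamp, Rdiv; rewrite Rmult_0_l, Rplus_0_r, Rminus_0_r; ring.
Qed.

(** In a corner the denominator of [fold_pos] collapses to [d], which leaves the triangle map with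
    [a = m - (1 - d)]. *)
Lemma fold_shell (d m h : R) : 0 < d <= 1 -> 1 - d <= m ->
  fold_mean d m h = m + clamp (Rabs h) (m - (1 - d)) /\
  d * fold_pos d m h = h + clamp (m - (1 - d)) h.
Proof.
  intros Hd H; unfold fold_mean, fold_pos; rewrite excess_shell by lra.
  split; [easy|].
  rewrite (Rabs_pos_eq m), (Rabs_pos_eq (m - (1 - d))) by lra.
  field; lra.
Qed.

(** The inverse of the triangle map. Put [b = u - (1 - d)] and [w = d * v]: where [Rabs h <= a] one
    has [w = 2 * h] and [b = a + Rabs h], elsewhere [b = 2 * a] and [Rabs w = Rabs h + a]. In both
    cases half of the smaller of [b] and [Rabs w] is what was added. *)
Lemma unfold_shell (d u v : R) : 0 < d <= 1 -> 1 - d <= u ->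
  unfold_mean d u v = u - clamp (Rabs (d * v)) (u - (1 - d)) / 2 /\
  unfold_diff d u v = d * v - clamp (u - (1 - d)) (d * v) / 2.
Proof.
  intros Hd H.
  assert (E : unfold_mean d u v = u - clamp (Rabs (d * v)) (u - (1 - d)) / 2).
  { unfold unfold_mean; rewrite excess_shell, Rabs_mult, (Rabs_pos_eq d); lra. }
  split; [easy|].
  (* The unfolded mean stays in the corner, where the first factor of [unfold_diff] equals [d]. *)
  assert (G : 1 - d <= unfold_mean d u v).
  { rewrite E; split_flat. }
  unfold unfold_diff; rewrite !excess_shell by lra.
  rewrite !Rabs_pos_eq by lra.
  rewrite <- (clamp_scale d (u - (1 - d)) v) by lra. field.
Qed.

(** In the mean coordinate [fold_mean] and [unfold_mean] are odd, [fold_pos] and [unfold_diff] even,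
    so only one of the two corners has to be examined. *)
Lemma opp_nonneg_ind (P : R -> Prop) :
  (forall m, P m -> P (- m)) -> (forall m, 0 <= m -> P m) -> forall m, P m.
Proof.
  intros Hs H m; destruct (Rle_dec 0 m) as [G|G]; [auto|].
  rewrite <- (Ropp_involutive m); apply Hs, H; lra.
Qed.

Section FixedWidth.
Variable d : R.
Hypothesis Hd : 0 < d <= 1.

Lemma fold_range (m h : R) : Rabs m + Rabs h <= 1 ->
  Rabs (fold_mean d m h) <= 1 /\ Rabs (fold_pos d m h) <= 1.
Proof using Hd.
  revert m; apply (opp_nonneg_ind (fun m => Rabs m + Rabs h <= 1 ->
    Rabs (fold_mean d m h) <= 1 /\ Rabs (fold_pos d m h) <= 1)).
  { intros m; now rewrite fold_mean_opp, fold_pos_opp, !Rabs_Ropp. }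
  intros m Hm H; destruct (Rle_dec m (1 - d)) as [G|G].
  - assert (Hm' := Rabs_pos_eq m Hm).
    rewrite fold_mean_core, fold_pos_core by lra; split; [split_flat|].
    unfold Rdiv; rewrite Rabs_mult, (Rabs_pos_eq (/ _)), Hm'
      by (apply Rlt_le, Rinv_0_lt_compat; lra).
    apply (Rmult_le_reg_r (1 - m)); [lra|]. field_simplify; lra.
  - destruct (fold_shell d m h) as [E1 E2]; [lra..|].
    rewrite E1; split; [split_flat|].
    (* In the corner [(m - (1 - d)) + Rabs h <= d], and the truncation adds at most [m - (1 - d)] to
       [Rabs h]. *)
    apply (Rmult_le_reg_l d); [lra|].
    rewrite <- (Rabs_pos_eq d) at 1 by lra.
    rewrite <- Rabs_mult, E2; clear E1 E2; split_flat.
Qed.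

Lemma unfold_range (u v : R) : Rabs u <= 1 -> Rabs v <= 1 ->
  Rabs (unfold_mean d u v) + Rabs (unfold_diff d u v) <= 1.
Proof using Hd.
  intros Hu Hv; revert u Hu; apply (opp_nonneg_ind (fun u => Rabs u <= 1 ->
    Rabs (unfold_mean d u v) + Rabs (unfold_diff d u v) <= 1)).
  { intros m; now rewrite unfold_mean_opp, unfold_diff_opp, !Rabs_Ropp. }
  intros u Hu H; rewrite (Rabs_pos_eq u Hu) in H.
  destruct (Rle_dec u (1 - d)) as [G|G].
  - assert (Hu' := Rabs_pos_eq u Hu).
    rewrite unfold_mean_core, unfold_diff_core by lra.
    rewrite Rabs_mult, Hu', (Rabs_pos_eq (1 - u)) by lra.
    assert (Rabs v * (1 - u) <= 1 * (1 - u)) by (apply Rmult_le_compat_r; lra). lra.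
  - destruct (unfold_shell d u v) as [-> ->]; [lra..|].
    assert (W : Rabs (d * v) <= d).
    { rewrite Rabs_mult, (Rabs_pos_eq d) by lra.
      rewrite <- (Rmult_1_r d) at 2; apply Rmult_le_compat_l; lra. }
    (* Only the product [d * v] occurs now, so replacing it by a variable makes the goal piecewise
       linear. *)
    revert W; generalize (d * v); intros w W; split_flat.
Qed.

Lemma fold_unfold (u v : R) : Rabs u <= 1 -> Rabs v <= 1 ->
  fold_mean d (unfold_mean d u v) (unfold_diff d u v) = u /\
  fold_pos d (unfold_mean d u v) (unfold_diff d u v) = v.
Proof using Hd.
  intros Hu Hv; revert u Hu; apply (opp_nonneg_ind (fun u => Rabs u <= 1 ->
    fold_mean d (unfold_mean d u v) (unfold_diff d u v) = u /\
    fold_pos d (unfold_mean d u v) (unfold_diff d u v) = v)).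
  { intros m; rewrite unfold_mean_opp, unfold_diff_opp, fold_mean_opp, fold_pos_opp,
      Rabs_Ropp.
    intros IH H; destruct (IH H) as [-> ->]; easy. }
  intros u Hu H; rewrite (Rabs_pos_eq u Hu) in H.
  destruct (Rle_dec u (1 - d)) as [G|G].
  - assert (Hu' := Rabs_pos_eq u Hu).
    rewrite unfold_mean_core, unfold_diff_core by lra.
    rewrite fold_mean_core, fold_pos_core by lra; split; [easy|].
    rewrite Hu'; field; lra.
  - destruct (unfold_shell d u v) as [E1 E2]; [lra..|].
    assert (W : Rabs (d * v) <= d).
    { rewrite Rabs_mult, (Rabs_pos_eq d) by lra.
      rewrite <- (Rmult_1_r d) at 2; apply Rmult_le_compat_l; lra. }
    destruct (fold_shell d (unfold_mean d u v) (unfold_diff d u v)) as [E3 E4];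
      [lra|rewrite E1; split_flat|].
    rewrite E3; split; [|apply (Rmult_eq_reg_l d); [rewrite E4|lra]];
      rewrite E1, E2; clear E1 E2 E3 E4; revert W; generalize (d * v); intros w W.
    + split_flat.
    + split_flat.
Qed.

Lemma unfold_fold (m h : R) : Rabs m + Rabs h <= 1 ->
  unfold_mean d (fold_mean d m h) (fold_pos d m h) = m /\
  unfold_diff d (fold_mean d m h) (fold_pos d m h) = h.
Proof using Hd.
  revert m; apply (opp_nonneg_ind (fun m => Rabs m + Rabs h <= 1 ->
    unfold_mean d (fold_mean d m h) (fold_pos d m h) = m /\
    unfold_diff d (fold_mean d m h) (fold_pos d m h) = h)).
  { intros m; rewrite fold_mean_opp, fold_pos_opp, unfold_mean_opp, unfold_diff_opp,
      Rabs_Ropp.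
    intros IH H; destruct (IH H) as [-> ->]; easy. }
  intros m Hm H; rewrite (Rabs_pos_eq m Hm) in H.
  destruct (Rle_dec m (1 - d)) as [G|G].
  - assert (Hm' := Rabs_pos_eq m Hm).
    rewrite fold_mean_core, fold_pos_core by lra.
    rewrite unfold_mean_core, unfold_diff_core by lra; split; [easy|].
    rewrite Hm'; field; lra.
  - destruct (fold_shell d m h) as [E1 E2]; [lra..|].
    destruct (unfold_shell d (fold_mean d m h) (fold_pos d m h)) as [-> ->];
      [lra|rewrite E1; split_flat|].
    rewrite E2, E1; clear E1 E2; split; split_flat.
Qed.

(** The added term is at most the excess in absolute value, and the excess of a point of [[-1, 1]]
    is at most [d]. *)
Lemma fold_mean_close (m h : R) : Rabs m <= 1 -> Rabs (fold_mean d m h - m) <= d.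
Proof using Hd.
  intros Hm; unfold fold_mean, excess; split_flat.
Qed.

(** Both summands of [fold_mean] are 1-Lipschitz for the sup norm, whatever the width; so the
    constant stays 2 at every depth of the tree. *)
Lemma fold_mean_lipschitz (m h m' h' r : R) :
  Rabs (m - m') <= r -> Rabs (h - h') <= r ->
  Rabs (fold_mean d m h - fold_mean d m' h') <= 2 * r.
Proof using Hd.
  intros H1 H2.
  assert (Rabs (clamp (Rabs h) (excess d m) - clamp (Rabs h') (excess d m')) <= r).
  { apply clamp_lipschitz; try apply Rabs_pos.
    - split_flat.
    - unfold excess; split_flat. }
  unfold fold_mean; revert H H1; clear.
  generalize (clamp (Rabs h) (excess d m)) (clamp (Rabs h') (excess d m')).
  intros; split_flat.
Qed.

End FixedWidth.

(** * Geometric limits and continuity *)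

Lemma half_pow_small (C eps : R) : 0 < eps -> exists n, C * (/ 2) ^ n < eps.
Proof.
  intros He; destruct (Rle_dec C 0) as [HC|HC].
  - exists 0%nat; simpl; lra.
  - destruct (pow_lt_1_zero (/ 2)) with (y := eps / C) as [n Hn].
    + rewrite Rabs_pos_eq; lra.
    + apply Rdiv_lt_0_compat; lra.
    + exists n; specialize (Hn n (le_n n)).
      rewrite Rabs_pos_eq in Hn by (apply pow_le; lra).
      apply (Rmult_lt_compat_l C) in Hn; [|lra].
      now replace (C * (eps / C)) with eps in Hn by (field; lra).
Qed.

(** A total function; the geometric estimates below ensure that the limit exists and is finite
    wherever its value matters. *)
Definition limit_of (s : nat -> R) : R := real (Lim_seq s).

Lemma lim_unique (s : nat -> R) (l C : R) :
  (forall n, Rabs (s n - l) <= C * (/ 2) ^ n) -> limit_of s = l.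
Proof.
  intros H; unfold limit_of; replace (Lim_seq s) with (Finite l); [easy|].
  symmetry; apply is_lim_seq_unique.
  apply is_lim_seq_spec; intros eps.
  destruct (half_pow_small C eps (cond_pos eps)) as [N HN].
  exists N; intros n Hn; eapply Rle_lt_trans; [apply H|].
  eapply Rle_lt_trans; [|exact HN].
  assert (0 <= C).
  { specialize (H 0%nat); simpl in H; pose proof (Rabs_pos (s 0%nat - l)); lra. }
  apply Rmult_le_compat_l; [easy|].
  replace n with (N + (n - N))%nat by lia; rewrite pow_add.
  rewrite <- (Rmult_1_r ((/ 2) ^ N)) at 2.
  apply Rmult_le_compat_l; [apply pow_le; lra|].
  rewrite <- (pow1 (n - N)); apply pow_incr; lra.
Qed.

Lemma lim_geometric (s : nat -> R) (C : R) :
  (forall n, Rabs (s (S n) - s n) <= C * (/ 2) ^ n) ->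
  forall n, Rabs (s n - limit_of s) <= 2 * C * (/ 2) ^ n.
Proof.
  intros H.
  (* The factor [1 - (/ 2) ^ k] is the exact partial geometric sum; without it the induction on [k]
     would not close. *)
  assert (B : forall n k, Rabs (s (n + k)%nat - s n) <= 2 * C * (/ 2) ^ n * (1 - (/ 2) ^ k)).
  { intros n k; induction k as [|k IH].
    - rewrite Nat.add_0_r, Rminus_diag, Rabs_R0; simpl; lra.
    - specialize (H (n + k)%nat); rewrite pow_add in H; rewrite Nat.add_succ_r; simpl.
      revert H IH; generalize (s (S (n + k))) (s (n + k)%nat) (s n); clear; intros.
      eapply Rle_trans; [|eapply Rle_trans; [apply (Rplus_le_compat _ _ _ _ H IH)|]];
        [split_flat|lra]. }
  assert (B' : forall n k, Rabs (s (n + k)%nat - s n) <= 2 * C * (/ 2) ^ n).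
  { intros n k; eapply Rle_trans; [apply B|].
    assert (0 <= 2 * C * (/ 2) ^ n).
    { pose proof (Rabs_pos (s (S n) - s n)); specialize (H n); lra. }
    rewrite <- (Rmult_1_r (2 * C * (/ 2) ^ n)) at 2; apply Rmult_le_compat_l; [easy|].
    assert (0 <= (/ 2) ^ k) by (apply pow_le; lra); lra. }
  assert (L : is_lim_seq s (limit_of s)).
  { apply Lim_seq_correct', ex_lim_seq_cauchy_corr; intros eps.
    destruct (half_pow_small (2 * (2 * C)) eps (cond_pos eps)) as [N HN].
    exists N; intros n k Hn Hk.
    pose proof (B' N (n - N)%nat) as B1; pose proof (B' N (k - N)%nat) as B2.
    replace (N + (n - N))%nat with n in B1 by lia.
    replace (N + (k - N))%nat with k in B2 by lia.
    revert B1 B2 HN; clear; intros; split_flat. }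
  intros n; rewrite Rabs_minus_sym.
  apply (is_lim_seq_le (fun k => Rabs (s (n + k)%nat - s n)) (fun _ => 2 * C * (/ 2) ^ n)
    (Rabs (limit_of s - s n)) (2 * C * (/ 2) ^ n)).
  - apply B'.
  - apply (is_lim_seq_abs _ (limit_of s - s n)), is_lim_seq_minus';
      [|apply is_lim_seq_const].
    apply is_lim_seq_ext with (fun k => s (k + n)%nat);
      [intros k; f_equal; lia|now apply is_lim_seq_incr_n].
  - apply is_lim_seq_const.
Qed.

(** The filter generated by the balls about [a]; it makes the filter calculus available for [dF] and
    [dH], which are bare functions. *)
Definition near {X : Type} (d : X -> X -> R) (a : X) (P : X -> Prop) : Prop :=
  exists delta : R, 0 < delta /\ forall b : X, d a b < delta -> P b.

#[global] Instance near_filter {X : Type} (d : X -> X -> R) (a : X) : Filter (near d a).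
Proof.
  constructor.
  - exists 1; split; [lra|easy].
  - intros P Q [e1 [H1 HP]] [e2 [H2 HQ]]; exists (Rmin e1 e2); split.
    + now apply Rmin_pos.
    + intros b Hb; split; [apply HP|apply HQ];
        (eapply Rlt_le_trans; [exact Hb|]); [apply Rmin_l|apply Rmin_r].
  - intros P Q HPQ [e [H HP]]; exists e; auto.
Qed.

Definition contin {X : Type} (d : X -> X -> R) (a : X) (f : X -> R) : Prop :=
  filterlim f (near d a) (locally (f a)).

Lemma contin_spec {X : Type} (d : X -> X -> R) (a : X) (f : X -> R) :
  contin d a f <-> forall eps, 0 < eps -> near d a (fun b => Rabs (f b - f a) < eps).
Proof.
  split.
  - intros H eps He; apply (H (fun y => Rabs (y - f a) < eps)).
    exists (mkposreal eps He); intros y Hy; exact Hy.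
  - intros H P [eps HP]; unfold filtermap.
    eapply filter_imp; [|apply (H eps (cond_pos eps))].
    intros b Hb; apply HP, Hb.
Qed.

Section Continuity.
Context {X : Type} (d : X -> X -> R) (a : X).

Lemma contin_const (c : R) : contin d a (fun _ => c).
Proof. apply filterlim_const. Qed.

Lemma contin_ext (f g : X -> R) :
  (forall b, f b = g b) -> contin d a f -> contin d a g.
Proof. intros H Hf; now replace g with f by now apply functional_extensionality. Qed.

Lemma contin_plus (f g : X -> R) :
  contin d a f -> contin d a g -> contin d a (fun b => f b + g b).
Proof.
  intros Hf Hg; apply (filterlim_comp_2 f g plus Hf Hg).
  apply (filterlim_plus (f a) (g a)).
Qed.

Lemma contin_mult (f g : X -> R) :
  contin d a f -> contin d a g -> contin d a (fun b => f b * g b).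
Proof.
  intros Hf Hg; apply (filterlim_comp_2 f g mult Hf Hg).
  apply (filterlim_mult (f a) (g a)).
Qed.

Lemma contin_comp (h : R -> R) (f : X -> R) :
  continuous h (f a) -> contin d a f -> contin d a (fun b => h (f b)).
Proof. intros Hh Hf; exact (filterlim_comp _ _ _ f h _ _ _ Hf Hh). Qed.

Lemma contin_opp (f : X -> R) : contin d a f -> contin d a (fun b => - f b).
Proof. apply contin_comp, (continuous_opp (fun x : R => x)), continuous_id. Qed.

Lemma contin_minus (f g : X -> R) :
  contin d a f -> contin d a g -> contin d a (fun b => f b - g b).
Proof. intros Hf Hg; now apply contin_plus; [|apply contin_opp]. Qed.

Lemma contin_abs (f : X -> R) : contin d a f -> contin d a (fun b => Rabs (f b)).
Proof. apply contin_comp, continuous_Rabs. Qed.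

Lemma contin_div (f g : X -> R) : g a <> 0 ->
  contin d a f -> contin d a g -> contin d a (fun b => f b / g b).
Proof.
  intros H Hf Hg; apply contin_mult; [easy|].
  apply contin_comp; [now apply continuous_Rinv|easy].
Qed.

Lemma contin_clamp (c f : X -> R) : contin d a c -> contin d a f ->
  contin d a (fun b => clamp (c b) (f b)).
Proof.
  intros Hc Hf; unfold clamp.
  apply contin_div; [lra| |apply contin_const].
  apply contin_minus; apply contin_abs; [apply contin_plus|apply contin_minus]; easy.
Qed.

Lemma contin_uniform_limit (g : nat -> X -> R) (l : X -> R) (C : R) :
  (forall n, contin d a (g n)) ->
  (forall n b, Rabs (g n b - l b) <= C * (/ 2) ^ n) -> contin d a l.
Proof.
  intros Hg Hl; apply contin_spec; intros eps He.
  destruct (half_pow_small C (eps / 3)) as [n Hn]; [lra|].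
  eapply filter_imp; [|apply (proj1 (contin_spec d a (g n)) (Hg n) (eps / 3)); lra].
  intros b Hb; pose proof (Hl n a) as H1; pose proof (Hl n b) as H2; simpl in Hb.
  revert Hb H1 H2 Hn; clear; intros; split_flat.
Qed.

End Continuity.

(** * Labelled binary trees *)

(** The ratio [/ 4] between levels beats the Lipschitz constant 2 of the rules: an error
    proportional to the width that climbs [n] levels is doubled [n] times and still shrinks like
    [(/ 2) ^ n]. *)
Definition width (p : positive) : R := (/ 4) ^ Pos.size_nat p.

Lemma width_bounds (p : positive) : 0 < width p <= 1.
Proof.
  unfold width; split; [apply pow_lt; lra|].
  rewrite <- (pow1 (Pos.size_nat p)); apply pow_incr; lra.
Qed.

Lemma width_xO (p : positive) : width (xO p) = width p / 4.
Proof. unfold width; simpl; field. Qed.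

Lemma width_xI (p : positive) : width (xI p) = width p / 4.
Proof. unfold width; simpl; field. Qed.

(* A labelling of the infinite binary tree is a function on [positive]: the root is
   [xH] and the children of [p] are [xO p] and [xI p]. *)
Definition rule : Type := positive -> R -> R -> R.

Definition bounded (m : positive -> R) : Prop := forall p, Rabs (m p) <= 1.

Definition consistent (q : rule) (m : positive -> R) : Prop :=
  forall p, m p = q p (m (xO p)) (m (xI p)).

Definition lipschitz2 (q : rule) : Prop := forall p x y x' y' r,
  Rabs (x - x') <= r -> Rabs (y - y') <= r -> Rabs (q p x y - q p x' y') <= 2 * r.

Definition preserves_bounds (q : rule) : Prop := forall p x y,
  Rabs x <= 1 -> Rabs y <= 1 -> Rabs (q p x y) <= 1.

Definition close (q q' : rule) : Prop := forall p x y,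
  Rabs x <= 1 -> Rabs y <= 1 -> Rabs (q p x y - q' p x y) <= width p.

Fixpoint iterate (q : rule) (m : positive -> R) (n : nat) (p : positive) : R :=
  match n with
  | O => m p
  | S n => q p (iterate q m n (xO p)) (iterate q m n (xI p))
  end.

Definition transfer (q : rule) (m : positive -> R) (p : positive) : R :=
  limit_of (fun n => iterate q m n p).

(** * Passing from one rule to a nearby one *)

Section Transfer.
Variables q q' : rule.
Hypothesis Lq : lipschitz2 q.
Hypothesis Pq : preserves_bounds q.
Hypothesis Cq : close q q'.

(** The two iterates first differ [n] levels below [p], by at most the width [width p / 4 ^ n]
    there; climbing back to [p] doubles this [n] times. *)
Lemma iterate_step (m : positive -> R) (n : nat) (p : positive) :
  consistent q' m -> bounded m ->
  Rabs (iterate q m (S n) p - iterate q m n p) <= width p * (/ 2) ^ n.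
Proof using Lq Cq.
  intros Hm Bm; revert p; induction n as [|n IH]; intros p.
  - simpl; rewrite (Hm p), Rmult_1_r; now apply Cq.
  - replace (width p * (/ 2) ^ S n) with (2 * (width p / 4 * (/ 2) ^ n))
      by (simpl; field).
    apply Lq; [rewrite <- width_xO|rewrite <- width_xI]; apply IH.
Qed.

Lemma iterate_transfer (m : positive -> R) (n : nat) (p : positive) :
  consistent q' m -> bounded m ->
  Rabs (iterate q m n p - transfer q m p) <= 2 * width p * (/ 2) ^ n.
Proof using Lq Cq.
  intros Hm Bm.
  apply (lim_geometric (fun n => iterate q m n p)); intros; now apply iterate_step.
Qed.

Lemma transfer_close (m : positive -> R) (p : positive) :
  consistent q' m -> bounded m -> Rabs (transfer q m p - m p) <= 2 * width p.
Proof using Lq Cq.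
  intros Hm Bm; rewrite Rabs_minus_sym.
  pose proof (iterate_transfer m 0 p Hm Bm) as H; simpl in H; lra.
Qed.

(** Iterating [q] reproduces [u] exactly, so an initial gap of order [width] is contracted by 2 per
    level. This is what makes the two transfers mutually inverse. *)
Lemma transfer_unique (m u : positive -> R) (C : R) :
  consistent q u -> (forall p, Rabs (m p - u p) <= C * width p) ->
  transfer q m = u.
Proof using Lq.
  intros Hu Hmu; apply functional_extensionality; intros p.
  apply (lim_unique _ _ (C * width p)); intros n; revert p.
  induction n as [|n IH]; intros p.
  - simpl; rewrite Rmult_1_r; apply Hmu.
  - replace (C * width p * (/ 2) ^ S n) with (2 * (C * (width p / 4) * (/ 2) ^ n))
      by (simpl; field).
    rewrite (Hu p).
    apply Lq; [rewrite <- width_xO|rewrite <- width_xI]; apply IH.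
Qed.

Lemma iterate_bounded (m : positive -> R) (n : nat) :
  bounded m -> bounded (iterate q m n).
Proof using Pq.
  intros Bm; induction n as [|n IH]; intros p; [apply Bm|].
  apply Pq; apply IH.
Qed.

Lemma transfer_bounded (m : positive -> R) :
  consistent q' m -> bounded m -> bounded (transfer q m).
Proof using Lq Pq Cq.
  intros Hm Bm p; apply le_epsilon; intros eps He.
  destruct (half_pow_small (2 * width p) eps He) as [n Hn].
  pose proof (iterate_transfer m n p Hm Bm) as H1.
  pose proof (iterate_bounded m n Bm p) as H2.
  revert H1 H2 Hn; clear; intros; split_flat.
Qed.

Lemma transfer_consistent (m : positive -> R) :
  consistent q' m -> bounded m -> consistent q (transfer q m).
Proof using Lq Cq.
  intros Hm Bm p.
  (* Iterate [S n] at [p] is [q] applied to iterate [n] at the children. Iterate [0] involves no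
     application of [q] and is compared by way of iterate [1]. *)
  apply (lim_unique _ _ (4 * width p)); intros [|n].
  - pose proof (iterate_step m 0 p Hm Bm) as H1.
    assert (H2 : Rabs (iterate q m 1 p - q p (transfer q m (xO p)) (transfer q m (xI p)))
      <= 2 * (width p / 2)).
    { apply Lq.
      - rewrite Rabs_minus_sym; eapply Rle_trans; [now apply transfer_close|].
        rewrite width_xO; lra.
      - rewrite Rabs_minus_sym; eapply Rle_trans; [now apply transfer_close|].
        rewrite width_xI; lra. }
    pose proof (width_bounds p) as Hw.
    simpl pow in *; revert H1 H2 Hw; generalize (iterate q m 1 p); clear.
    intros; split_flat.
  - apply Rle_trans with (2 * (2 * (width p / 4) * (/ 2) ^ n)).
    + apply Lq; [rewrite <- width_xO|rewrite <- width_xI]; now apply iterate_transfer.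
    + assert (0 <= width p * (/ 2) ^ n)
        by (apply Rmult_le_pos; [apply Rlt_le, width_bounds|apply pow_le; lra]).
      simpl; lra.
Qed.

(** Each iterate is a finite composition of continuous rules, and the rate of convergence is uniform
    in the labelling. *)
Lemma transfer_contin {X : Type} (d : X -> X -> R) (a : X) (m : X -> positive -> R) :
  (forall p f g, contin d a f -> contin d a g -> contin d a (fun b => q p (f b) (g b))) ->
  (forall b, consistent q' (m b)) -> (forall b, bounded (m b)) ->
  (forall p, contin d a (fun b => m b p)) ->
  forall p, contin d a (fun b => transfer q (m b) p).
Proof using Lq Cq.
  intros Qc Hm Bm Cm p.
  apply (contin_uniform_limit d a (fun n b => iterate q (m b) n p) _ (2 * width p)).
  - intros n; revert p; induction n as [|n IH]; intros p; simpl; auto.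
  - intros n b; now apply iterate_transfer.
Qed.

End Transfer.

(** The labelling [m] is itself consistent with [q'] and lies within [2 * width] of [transfer q m],
    so uniqueness identifies it as the transfer back. *)
Lemma transfer_cancel (q q' : rule) (m : positive -> R) :
  lipschitz2 q -> lipschitz2 q' -> close q q' ->
  consistent q' m -> bounded m -> transfer q' (transfer q m) = m.
Proof.
  intros Lq Lq' C Hm Bm.
  apply (transfer_unique q' Lq' _ _ 2); [easy|].
  intros p; now apply (transfer_close q q').
Qed.

(** * Averaging, bending, and continuity of the rules *)

Definition mean : rule := fun _ x y => (x + y) / 2.
Definition bend : rule := fun p x y => fold_mean (width p) ((x + y) / 2) ((x - y) / 2).
Definition residue : rule := fun p x y => fold_pos (width p) ((x + y) / 2) ((x - y) / 2).
Definition left_child : rule :=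
  fun p u v => unfold_mean (width p) u v + unfold_diff (width p) u v.
Definition right_child : rule :=
  fun p u v => unfold_mean (width p) u v - unfold_diff (width p) u v.

(** The left-hand side is the maximum of [Rabs x] and [Rabs y]. *)
Lemma diamond (x y : R) : Rabs x <= 1 -> Rabs y <= 1 ->
  Rabs ((x + y) / 2) + Rabs ((x - y) / 2) <= 1.
Proof. intros; split_flat. Qed.

Lemma mean_lipschitz2 : lipschitz2 mean.
Proof. intros p x y x' y' r H1 H2; unfold mean; split_flat. Qed.

Lemma mean_preserves_bounds : preserves_bounds mean.
Proof. intros p x y H1 H2; unfold mean; split_flat. Qed.

Lemma bend_lipschitz2 : lipschitz2 bend.
Proof.
  intros p x y x' y' r H1 H2.
  apply fold_mean_lipschitz; [apply width_bounds| |]; split_flat.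
Qed.

Lemma bend_preserves_bounds : preserves_bounds bend.
Proof.
  intros p x y H1 H2; apply fold_range; [apply width_bounds|now apply diamond].
Qed.

Lemma residue_preserves_bounds : preserves_bounds residue.
Proof.
  intros p x y H1 H2; apply fold_range; [apply width_bounds|now apply diamond].
Qed.

Lemma bend_close : close bend mean.
Proof.
  intros p x y H1 H2; apply fold_mean_close; [apply width_bounds|].
  now apply (mean_preserves_bounds p).
Qed.

Lemma mean_close : close mean bend.
Proof. intros p x y H1 H2; rewrite Rabs_minus_sym; now apply bend_close. Qed.

Lemma left_child_preserves_bounds : preserves_bounds left_child.
Proof.
  intros p u v H1 H2; unfold left_child.
  pose proof (unfold_range (width p) (width_bounds p) u v H1 H2) as H.
  eapply Rle_trans; [apply Rabs_triang|exact H].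
Qed.

Lemma right_child_preserves_bounds : preserves_bounds right_child.
Proof.
  intros p u v H1 H2; unfold right_child.
  pose proof (unfold_range (width p) (width_bounds p) u v H1 H2) as H.
  eapply Rle_trans; [apply Rabs_triang|now rewrite Rabs_Ropp].
Qed.

Lemma bend_children (p : positive) (u v : R) : Rabs u <= 1 -> Rabs v <= 1 ->
  bend p (left_child p u v) (right_child p u v) = u /\
  residue p (left_child p u v) (right_child p u v) = v.
Proof.
  intros H1 H2; unfold bend, residue, left_child, right_child.
  match goal with |- context [fold_mean _ ?m ?h] =>
    replace m with (unfold_mean (width p) u v) by field;
    replace h with (unfold_diff (width p) u v) by field end.
  apply fold_unfold; [apply width_bounds|easy..].
Qed.

Lemma children_bend (p : positive) (x y : R) : Rabs x <= 1 -> Rabs y <= 1 ->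
  left_child p (bend p x y) (residue p x y) = x /\
  right_child p (bend p x y) (residue p x y) = y.
Proof.
  intros H1 H2; unfold bend, residue, left_child, right_child.
  destruct (unfold_fold (width p) (width_bounds p) ((x + y) / 2) ((x - y) / 2)) as [-> ->];
    [now apply diamond|split; field].
Qed.

Section RuleContinuity.
Context {X : Type} (d : X -> X -> R) (a : X) (p : positive) (f g : X -> R).
Hypotheses (Hf : contin d a f) (Hg : contin d a g).

Lemma contin_excess (w : R) (h : X -> R) :
  contin d a h -> contin d a (fun b => excess w (h b)).
Proof using.
  intros Hh; unfold excess; apply contin_minus; [easy|].
  apply contin_clamp; [apply contin_const|easy].
Qed.

Lemma contin_mean : contin d a (fun b => mean p (f b) (g b)).
Proof using Hf Hg.
  apply contin_div; [lra|now apply contin_plus|apply contin_const].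
Qed.

Lemma contin_half_diff : contin d a (fun b => (f b - g b) / 2).
Proof using Hf Hg.
  apply contin_div; [lra|now apply contin_minus|apply contin_const].
Qed.

Lemma contin_bend : contin d a (fun b => bend p (f b) (g b)).
Proof using Hf Hg.
  unfold bend, fold_mean.
  pose proof contin_mean as Hm; pose proof contin_half_diff as Hh.
  apply contin_plus; [easy|].
  apply contin_clamp; [now apply contin_abs|now apply contin_excess].
Qed.

(** The value is in fact at least [w]: in the core [1 - Rabs m >= w], and outside it the sum is
    exactly [w]. *)
Lemma fold_pos_denominator (w m : R) : 0 < w <= 1 -> Rabs m <= 1 ->
  0 < 1 - Rabs m + Rabs (excess w m).
Proof using.
  intros Hw H; unfold excess.
  destruct (Rle_dec (Rabs m) (1 - w)) as [G|G].
  - rewrite clamp_id by easy; pose proof (Rabs_pos (m - m)); lra.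
  - split_flat.
Qed.

Lemma contin_residue : Rabs (f a) <= 1 -> Rabs (g a) <= 1 ->
  contin d a (fun b => residue p (f b) (g b)).
Proof using Hf Hg.
  intros H1 H2; unfold residue, fold_pos.
  pose proof contin_mean as Hm; pose proof contin_half_diff as Hh.
  pose proof (contin_abs d a _ (contin_excess (width p) _ Hm)) as He.
  apply contin_div.
  - apply Rgt_not_eq, fold_pos_denominator; [apply width_bounds|].
    now apply (mean_preserves_bounds p).
  - apply contin_plus; [easy|now apply contin_clamp].
  - apply contin_plus; [|easy].
    apply contin_minus; [apply contin_const|now apply contin_abs].
Qed.

Lemma contin_unfold_mean : contin d a (fun b => unfold_mean (width p) (f b) (g b)).
Proof using Hf Hg.
  apply contin_minus; [easy|]. apply contin_div; [lra| |apply contin_const].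
  apply contin_clamp; [|now apply contin_excess].
  apply contin_mult; [apply contin_const|now apply contin_abs].
Qed.

Lemma contin_unfold_diff : contin d a (fun b => unfold_diff (width p) (f b) (g b)).
Proof using Hf Hg.
  pose proof contin_unfold_mean as Hm.
  apply contin_mult.
  - apply contin_plus; [|now apply contin_abs, contin_excess].
    apply contin_minus; [apply contin_const|now apply contin_abs].
  - apply contin_minus; [easy|]. apply contin_div; [lra| |apply contin_const].
    apply contin_clamp; [|easy].
    apply contin_div; [|now apply contin_abs, contin_excess|apply contin_const].
    pose proof (width_bounds p); lra.
Qed.

Lemma contin_left_child : contin d a (fun b => left_child p (f b) (g b)).
Proof using Hf Hg.
  apply contin_plus; [apply contin_unfold_mean|apply contin_unfold_diff].
Qed.

Lemma contin_right_child : contin d a (fun b => right_child p (f b) (g b)).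
Proof using Hf Hg.
  apply contin_minus; [apply contin_unfold_mean|apply contin_unfold_diff].
Qed.

End RuleContinuity.

(** * Free coordinates for labellings consistent with [bend] *)

(* Cube coordinate [0] is the label of the root, coordinate [k >= 1] the residue at the
   [k]-th node. *)
Definition code (u : positive -> R) (n : nat) : R :=
  match n with
  | O => u xH
  | S k => let p := Pos.of_succ_nat k in residue p (u (xO p)) (u (xI p))
  end.

Fixpoint decode (x : nat -> R) (p : positive) : R :=
  match p with
  | xH => x O
  | xO p => left_child p (decode x p) (x (Pos.to_nat p))
  | xI p => right_child p (decode x p) (x (Pos.to_nat p))
  end.

Lemma code_node (u : positive -> R) (p : positive) :
  code u (Pos.to_nat p) = residue p (u (xO p)) (u (xI p)).
Proof.
  destruct (Pos2Nat.is_succ p) as [k Hk]; rewrite Hk; unfold code.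
  replace (Pos.of_succ_nat k) with p; [easy|].
  apply Pos2Nat.inj; rewrite SuccNat2Pos.id_succ; easy.
Qed.

Lemma code_bounded (u : positive -> R) (n : nat) : bounded u -> Rabs (code u n) <= 1.
Proof.
  intros Bu; destruct n as [|k]; [apply Bu|].
  apply residue_preserves_bounds; apply Bu.
Qed.

Lemma decode_bounded (x : nat -> R) : (forall n, Rabs (x n) <= 1) -> bounded (decode x).
Proof.
  intros Hx p; induction p as [p IH|p IH|]; [| |apply Hx].
  - now apply right_child_preserves_bounds.
  - now apply left_child_preserves_bounds.
Qed.

Lemma decode_consistent (x : nat -> R) :
  (forall n, Rabs (x n) <= 1) -> consistent bend (decode x).
Proof.
  intros Hx p; symmetry; apply bend_children; [now apply decode_bounded|easy].
Qed.

(** Descending from the root: consistency makes the label of [p] the [bend] of its children, and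
    together with the residue at [p] it determines both of them. *)
Lemma decode_code (u : positive -> R) : consistent bend u -> bounded u ->
  decode (code u) = u.
Proof.
  intros Hu Bu; apply functional_extensionality; intros p.
  induction p as [p IH|p IH|]; [| |easy]; simpl; rewrite IH, code_node, (Hu p);
    apply children_bend; apply Bu.
Qed.

Lemma code_decode (x : nat -> R) : (forall n, Rabs (x n) <= 1) -> code (decode x) = x.
Proof.
  intros Hx; apply functional_extensionality; intros [|k]; [easy|].
  rewrite <- (SuccNat2Pos.id_succ k), code_node.
  apply bend_children; [now apply decode_bounded|easy].
Qed.

Lemma contin_code {X : Type} (d : X -> X -> R) (a : X) (u : X -> positive -> R) (n : nat) :
  bounded (u a) -> (forall p, contin d a (fun b => u b p)) ->
  contin d a (fun b => code (u b) n).
Proof.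
  intros Bu Hu; destruct n as [|k]; [apply Hu|].
  apply contin_residue; easy.
Qed.

Lemma contin_decode {X : Type} (d : X -> X -> R) (a : X) (x : X -> nat -> R)
  (p : positive) :
  (forall n, contin d a (fun b => x b n)) -> contin d a (fun b => decode (x b) p).
Proof.
  intros Hx; induction p as [p IH|p IH|]; [| |apply Hx].
  - now apply contin_right_child.
  - now apply contin_left_child.
Qed.

(** * Lipschitz functions and their dyadic slopes *)

Lemma lim_unique_S (s : nat -> R) (l C : R) :
  (forall n, Rabs (s (S n) - l) <= C * (/ 2) ^ n) -> limit_of s = l.
Proof.
  intros H; rewrite <- (lim_unique (fun n => s (S n)) l C H).
  unfold limit_of; now rewrite Lim_seq_incr_1.
Qed.

Definition lipschitz1 (F : R -> R) : Prop :=
  forall s t, 0 <= s <= t -> t <= 1 -> Rabs (F t - F s) <= t - s.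

(** For [m] consistent with [mean]: the continuous piecewise linear function on [[0, 1]] vanishing
    at [0] whose slopes on the [2 ^ n] equal pieces are the labels [n] levels below [p]. The offset
    [m (xO p) / 2] is the increment over the left half. *)
Fixpoint interpolate (m : positive -> R) (n : nat) (p : positive) (t : R) : R :=
  match n with
  | O => m p * t
  | S n => if Rle_dec t (/ 2) then interpolate m n (xO p) (2 * t) / 2
           else m (xO p) / 2 + interpolate m n (xI p) (2 * t - 1) / 2
  end.

Lemma interpolate_S (m : positive -> R) (n : nat) (p : positive) (t : R) :
  interpolate m (S n) p t =
  if Rle_dec t (/ 2) then interpolate m n (xO p) (2 * t) / 2
  else m (xO p) / 2 + interpolate m n (xI p) (2 * t - 1) / 2.
Proof. easy. Qed.

Definition primitive (m : positive -> R) (p : positive) (t : R) : R :=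
  limit_of (fun n => interpolate m n p t).

Section Primitive.
Variable m : positive -> R.
Hypothesis Hm : consistent mean m.
Hypothesis Bm : bounded m.

Lemma interpolate_0 (n : nat) (p : positive) : interpolate m n p 0 = 0.
Proof using.
  revert p; induction n as [|n IH]; intros p; simpl; [ring|].
  destruct (Rle_dec 0 (/ 2)); [|lra].
  rewrite Rmult_0_r, IH; lra.
Qed.

Lemma interpolate_1 (n : nat) (p : positive) : interpolate m n p 1 = m p.
Proof using Hm.
  revert p; induction n as [|n IH]; intros p; simpl; [ring|].
  destruct (Rle_dec 1 (/ 2)); [lra|].
  replace (2 * 1 - 1) with 1 by ring; rewrite IH, (Hm p); unfold mean; lra.
Qed.

Lemma interpolate_lipschitz (n : nat) (p : positive) : lipschitz1 (interpolate m n p).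
Proof using Hm Bm.
  revert p; induction n as [|n IH]; intros p s t Hs Ht; simpl.
  - rewrite <- Rmult_minus_distr_l, Rabs_mult, (Rabs_pos_eq (t - s)) by lra.
    rewrite <- (Rmult_1_l (t - s)) at 2; apply Rmult_le_compat_r; [lra|apply Bm].
  - destruct (Rle_dec t (/ 2)) as [H1|H1], (Rle_dec s (/ 2)) as [H2|H2]; [|lra| |].
    + assert (H := IH (xO p) (2 * s) (2 * t)); revert H.
      generalize (interpolate m n (xO p) (2 * s)) (interpolate m n (xO p) (2 * t)).
      intros x y H; assert (Rabs (y - x) <= 2 * t - 2 * s) by (apply H; lra).
      clear H; split_flat.
    (* The points lie in different halves: the estimate passes through the midpoint. *)
    + assert (G := IH (xO p) (2 * s) 1); assert (H := IH (xI p) 0 (2 * t - 1)).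
      rewrite interpolate_0 in H; rewrite interpolate_1 in G; revert G H.
      generalize (interpolate m n (xO p) (2 * s)) (interpolate m n (xI p) (2 * t - 1)).
      intros x y G H.
      assert (Rabs (y - 0) <= 2 * t - 1 - 0) by (apply H; lra).
      assert (Rabs (m (xO p) - x) <= 1 - 2 * s) by (apply G; lra).
      clear G H; split_flat.
    + assert (H := IH (xI p) (2 * s - 1) (2 * t - 1)); revert H.
      generalize (interpolate m n (xI p) (2 * s - 1)) (interpolate m n (xI p) (2 * t - 1)).
      intros x y H; assert (Rabs (y - x) <= 2 * t - 1 - (2 * s - 1)) by (apply H; lra).
      clear H; split_flat.
Qed.

(** At depth [0], two 1-Lipschitz functions on [[0, 1]] agreeing at both ends differ by at most 1;
    every further subdivision halves the gap. *)
Lemma interpolate_step (n : nat) (p : positive) (t : R) : 0 <= t <= 1 ->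
  Rabs (interpolate m (S n) p t - interpolate m n p t) <= 1 * (/ 2) ^ n.
Proof using Hm Bm.
  revert p t; induction n as [|n IH]; intros p t Ht.
  - assert (H1 := interpolate_lipschitz 0 p 0 t).
    assert (H2 := interpolate_lipschitz 0 p t 1).
    assert (H3 := interpolate_lipschitz 1 p 0 t).
    assert (H4 := interpolate_lipschitz 1 p t 1).
    rewrite interpolate_0 in H1, H3; rewrite interpolate_1 in H2, H4.
    revert H1 H2 H3 H4; generalize (interpolate m 0 p t) (interpolate m 1 p t) (m p).
    intros x y z H1 H2 H3 H4; specialize (H1 ltac:(lra) ltac:(lra)).
    specialize (H2 ltac:(lra) ltac:(lra)); specialize (H3 ltac:(lra) ltac:(lra)).
    specialize (H4 ltac:(lra) ltac:(lra)); simpl; split_flat.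
  - replace (1 * (/ 2) ^ S n) with (1 * (/ 2) ^ n / 2) by (simpl; field).
    rewrite (interpolate_S m (S n) p t), (interpolate_S m n p t).
    destruct (Rle_dec t (/ 2)) as [H|H].
    + assert (G := IH (xO p) (2 * t) ltac:(lra)); revert G.
      generalize (interpolate m (S n) (xO p) (2 * t)) (interpolate m n (xO p) (2 * t)).
      clear; intros; split_flat.
    + assert (G := IH (xI p) (2 * t - 1) ltac:(lra)); revert G.
      generalize (interpolate m (S n) (xI p) (2 * t - 1))
        (interpolate m n (xI p) (2 * t - 1)).
      clear; intros; split_flat.
Qed.

Lemma interpolate_primitive (n : nat) (p : positive) (t : R) : 0 <= t <= 1 ->
  Rabs (interpolate m n p t - primitive m p t) <= 2 * (/ 2) ^ n.
Proof using Hm Bm.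
  intros Ht; replace (2 * (/ 2) ^ n) with (2 * 1 * (/ 2) ^ n) by ring.
  apply (lim_geometric (fun n => interpolate m n p t)).
  intros k; now apply interpolate_step.
Qed.

Lemma primitive_0 (p : positive) : primitive m p 0 = 0.
Proof using.
  apply (lim_unique _ _ 0); intros n; rewrite interpolate_0, Rminus_0_r, Rabs_R0; lra.
Qed.

Lemma primitive_1 (p : positive) : primitive m p 1 = m p.
Proof using Hm.
  apply (lim_unique _ _ 0); intros n; rewrite interpolate_1, Rminus_diag, Rabs_R0; lra.
Qed.

Lemma primitive_left (p : positive) (t : R) : 0 <= t <= 1 ->
  primitive m p (t / 2) = primitive m (xO p) t / 2.
Proof using Hm Bm.
  intros Ht; apply (lim_unique_S _ _ 1); intros n; simpl.
  destruct (Rle_dec (t / 2) (/ 2)); [|lra].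
  replace (2 * (t / 2)) with t by field.
  assert (H := interpolate_primitive n (xO p) t Ht); revert H; clear; intros; split_flat.
Qed.

Lemma primitive_right (p : positive) (t : R) : 0 <= t <= 1 ->
  primitive m p ((1 + t) / 2) = m (xO p) / 2 + primitive m (xI p) t / 2.
Proof using Hm Bm.
  intros Ht; apply (lim_unique_S _ _ 1); intros n; simpl.
  destruct (Rle_dec ((1 + t) / 2) (/ 2)).
  (* [interpolate] assigns the midpoint to its left branch. *)
  - assert (t = 0) as -> by lra.
    replace (2 * ((1 + 0) / 2)) with 1 by field.
    rewrite interpolate_1, primitive_0, Rdiv_0_l, Rplus_0_r, Rminus_diag, Rabs_R0.
    assert (0 <= (/ 2) ^ n) by (apply pow_le; lra); lra.
  - replace (2 * ((1 + t) / 2) - 1) with t by field.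
    assert (H := interpolate_primitive n (xI p) t Ht); revert H; clear; intros; split_flat.
Qed.

Lemma primitive_lipschitz (p : positive) : lipschitz1 (primitive m p).
Proof using Hm Bm.
  intros s t Hs Ht; apply le_epsilon; intros eps He.
  destruct (half_pow_small 4 eps He) as [n Hn].
  assert (H1 := interpolate_lipschitz n p s t Hs Ht).
  assert (H2 := interpolate_primitive n p s ltac:(lra)).
  assert (H3 := interpolate_primitive n p t ltac:(lra)).
  revert Hn H1 H2 H3; clear; intros; split_flat.
Qed.

End Primitive.

(** Node [p] stands for the dyadic interval of this length starting at [node_start p]; its children
    are the two halves, the root is [[0, 1]]. *)
Fixpoint node_length (p : positive) : R :=
  match p with
  | xH => 1
  | xO p | xI p => node_length p / 2
  end.

Fixpoint node_start (p : positive) : R :=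
  match p with
  | xH => 0
  | xO p => node_start p
  | xI p => node_start p + node_length p / 2
  end.

Lemma node_bounds (p : positive) :
  0 < node_length p /\ 0 <= node_start p /\ node_start p + node_length p <= 1.
Proof. induction p as [p IH|p IH|]; simpl; lra. Qed.

Definition slope (F : R -> R) (p : positive) : R :=
  (F (node_start p + node_length p) - F (node_start p)) / node_length p.

(** [F] on the interval of [p], blown up to [[0, 1]] with slopes preserved and the value at the left
    end moved to [0]. *)
Definition rescale (F : R -> R) (p : positive) (t : R) : R :=
  (F (node_start p + t * node_length p) - F (node_start p)) / node_length p.

Lemma slope_consistent (F : R -> R) : consistent mean (slope F).
Proof.
  intros p; pose proof (node_bounds p); unfold mean, slope; simpl.
  replace (node_start p + node_length p / 2 + node_length p / 2)
    with (node_start p + node_length p) by field.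
  field; lra.
Qed.

Lemma rescale_lipschitz (F : R -> R) (p : positive) :
  lipschitz1 F -> lipschitz1 (rescale F p).
Proof.
  intros LF s t Hs Ht; pose proof (node_bounds p) as (Hl & H0 & H1); unfold rescale.
  replace ((F (node_start p + t * node_length p) - F (node_start p)) / node_length p
    - (F (node_start p + s * node_length p) - F (node_start p)) / node_length p)
  with ((F (node_start p + t * node_length p) - F (node_start p + s * node_length p))
    * / node_length p) by (field; lra).
  rewrite Rabs_mult, (Rabs_pos_eq (/ _)) by (apply Rlt_le, Rinv_0_lt_compat; lra).
  apply (Rmult_le_reg_r (node_length p)); [easy|].
  rewrite Rmult_assoc, Rinv_l, Rmult_1_r by lra.
  assert (0 <= s * node_length p) by (apply Rmult_le_pos; lra).
  assert (s * node_length p <= t * node_length p) by (apply Rmult_le_compat_r; lra).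
  assert (t * node_length p <= 1 * node_length p) by (apply Rmult_le_compat_r; lra).
  eapply Rle_trans; [apply LF; lra|lra].
Qed.

Lemma rescale_0 (F : R -> R) (p : positive) : rescale F p 0 = 0.
Proof.
  pose proof (node_bounds p); unfold rescale; rewrite Rmult_0_l, Rplus_0_r; field; lra.
Qed.

Lemma rescale_1 (F : R -> R) (p : positive) : rescale F p 1 = slope F p.
Proof. unfold rescale; now rewrite Rmult_1_l. Qed.

Lemma slope_bounded (F : R -> R) : lipschitz1 F -> bounded (slope F).
Proof.
  intros LF p; pose proof (rescale_lipschitz F p LF 0 1) as H.
  rewrite rescale_0, rescale_1, Rminus_0_r in H; eapply Rle_trans; [apply H|]; lra.
Qed.

(** [interpolate (slope F)] and [rescale F] obey the same recursion over the two halves, so their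
    initial gap, at most 2, is halved at each level. *)
Lemma primitive_slope (F : R -> R) (p : positive) (t : R) : lipschitz1 F ->
  0 <= t <= 1 -> primitive (slope F) p t = rescale F p t.
Proof.
  intros LF Ht; apply (lim_unique _ _ 2); intros n; revert p t Ht.
  induction n as [|n IH]; intros p t Ht.
  - assert (H1 := interpolate_lipschitz _ (slope_consistent F) (slope_bounded F LF) 0 p 0 t).
    assert (H2 := rescale_lipschitz F p LF 0 t).
    rewrite interpolate_0 in H1; rewrite rescale_0 in H2.
    revert H1 H2; generalize (interpolate (slope F) 0 p t) (rescale F p t).
    intros x y H1 H2; specialize (H1 ltac:(lra) ltac:(lra)).
    specialize (H2 ltac:(lra) ltac:(lra)); simpl; split_flat.
  - pose proof (node_bounds p) as Hp; simpl; destruct (Rle_dec t (/ 2)) as [H|H].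
    + replace (rescale F p t) with (rescale F (xO p) (2 * t) / 2).
      * assert (G := IH (xO p) (2 * t) ltac:(lra)); revert G; clear; intros; split_flat.
      * unfold rescale; simpl.
        replace (2 * t * (node_length p / 2)) with (t * node_length p) by field.
        field; lra.
    + replace (rescale F p t)
        with (slope F (xO p) / 2 + rescale F (xI p) (2 * t - 1) / 2).
      * assert (G := IH (xI p) (2 * t - 1) ltac:(lra)); revert G; clear; intros; split_flat.
      * unfold rescale, slope; simpl.
        replace (node_start p + node_length p / 2 + (2 * t - 1) * (node_length p / 2))
          with (node_start p + t * node_length p) by field.
        field; lra.
Qed.

Lemma rescale_primitive (m : positive -> R) (p : positive) (t : R) :
  consistent mean m -> bounded m -> 0 <= t <= 1 ->
  rescale (primitive m xH) p t = primitive m p t.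
Proof.
  intros Hm Bm; revert t; induction p as [p IH|p IH|]; intros t Ht.
  - pose proof (node_bounds p) as Hp.
    (* The function at the right child is twice the increment of its parent from the midpoint, which
       is written [(1 + 0) / 2] so that [primitive_right] applies to it. *)
    assert (H1 := IH ((1 + t) / 2) ltac:(lra)); assert (H2 := IH (/ 2) ltac:(lra)).
    rewrite primitive_right in H1 by easy.
    replace (/ 2) with ((1 + 0) / 2) in H2 by field.
    rewrite primitive_right, primitive_0 in H2 by (easy || lra).
    transitivity (2 * (m (xO p) / 2 + primitive m (xI p) t / 2 - (m (xO p) / 2 + 0 / 2)));
      [|field].
    rewrite <- H1, <- H2; unfold rescale; simpl.
    replace (node_start p + node_length p / 2 + t * (node_length p / 2))
      with (node_start p + (1 + t) / 2 * node_length p) by field.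
    replace (node_start p + (1 + 0) / 2 * node_length p)
      with (node_start p + node_length p / 2) by field.
    field; lra.
  - pose proof (node_bounds p) as Hp.
    assert (H1 := IH (t / 2) ltac:(lra)).
    rewrite primitive_left in H1 by easy.
    transitivity (2 * (primitive m (xO p) t / 2)); [|field].
    rewrite <- H1; unfold rescale; simpl.
    replace (t * (node_length p / 2)) with (t / 2 * node_length p) by field.
    field; lra.
  - unfold rescale; simpl; rewrite Rplus_0_l, primitive_0, Rmult_1_r; field.
Qed.

Lemma slope_primitive (m : positive -> R) : consistent mean m -> bounded m ->
  slope (primitive m xH) = m.
Proof.
  intros Hm Bm; apply functional_extensionality; intros p.
  rewrite <- rescale_1, rescale_primitive, primitive_1 by (easy || lra); easy.
Qed.

Lemma slope_ext (F G : R -> R) (c : R) : (forall t, 0 <= t <= 1 -> F t = c + G t) ->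
  slope F = slope G.
Proof.
  intros H; apply functional_extensionality; intros p.
  pose proof (node_bounds p); unfold slope; rewrite !H by lra; field; lra.
Qed.

(** Only finitely many labels enter at level [n], so label-by-label continuity gives an estimate
    uniform in [t]. *)
Lemma interpolate_near {X : Type} (d : X -> X -> R) (a : X) (m : X -> positive -> R)
  (n : nat) (p : positive) (eps : R) :
  (forall p, contin d a (fun b => m b p)) -> 0 < eps ->
  near d a (fun b => forall t, 0 <= t <= 1 ->
    Rabs (interpolate (m b) n p t - interpolate (m a) n p t) < eps).
Proof.
  intros Cm He; revert p; induction n as [|n IH]; intros p.
  - eapply filter_imp; [|apply (proj1 (contin_spec _ _ _) (Cm p) eps He)].
    intros b Hb t Ht; simpl in *.
    rewrite <- Rmult_minus_distr_r, Rabs_mult, (Rabs_pos_eq t) by lra.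
    pose proof (Rabs_pos (m b p - m a p)) as H0.
    assert (Rabs (m b p - m a p) * t <= Rabs (m b p - m a p) * 1)
      by (apply Rmult_le_compat_l; lra).
    lra.
  - eapply filter_imp; [|apply (filter_and _ _
      (proj1 (contin_spec _ _ _) (Cm (xO p)) eps He)
      (filter_and _ _ (IH (xO p)) (IH (xI p))))].
    intros b (H0 & HO & HI) t Ht; simpl in *.
    destruct (Rle_dec t (/ 2)) as [H|H].
    + assert (G := HO (2 * t) ltac:(lra)); revert G; clear; intros; split_flat.
    + assert (G := HI (2 * t - 1) ltac:(lra)); revert G H0; clear; intros; split_flat.
Qed.

(** The convergence rate of [interpolate] is the same for all labellings; hence continuity of the
    single labels already gives continuity in the sup norm. *)
Lemma primitive_near {X : Type} (d : X -> X -> R) (a : X) (m : X -> positive -> R)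
  (p : positive) (eps : R) :
  (forall b, consistent mean (m b)) -> (forall b, bounded (m b)) ->
  (forall p, contin d a (fun b => m b p)) -> 0 < eps ->
  near d a (fun b => forall t, 0 <= t <= 1 ->
    Rabs (primitive (m b) p t - primitive (m a) p t) < eps).
Proof.
  intros Hm Bm Cm He; destruct (half_pow_small 2 (eps / 4)) as [n Hn]; [lra|].
  eapply filter_imp; [|apply (interpolate_near d a m n p (eps / 4) Cm); lra].
  intros b Hb t Ht; assert (H0 := Hb t Ht); simpl in H0.
  assert (H1 := interpolate_primitive _ (Hm a) (Bm a) n p t Ht).
  assert (H2 := interpolate_primitive _ (Hm b) (Bm b) n p t Ht).
  revert Hn H0 H1 H2; clear; intros; split_flat.
Qed.

(** * The reduced tight span *)

Lemma clip_proof (x : R) : 0 <= Rmax 0 (Rmin x PI) <= PI.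
Proof.
  pose proof PI_RGT_0; split; [apply Rmax_l|apply Rmax_lub; [lra|apply Rmin_r]].
Qed.

Definition clip (x : R) : I0pi := exist _ (Rmax 0 (Rmin x PI)) (clip_proof x).

Lemma clip_val (x : R) : 0 <= x <= PI -> proj1_sig (clip x) = x.
Proof. intros H; simpl; rewrite Rmin_left, Rmax_right; lra. Qed.

Lemma clip_id (x : I0pi) : clip (proj1_sig x) = x.
Proof. apply eq_sig_hprop; [intros; apply proof_irrelevance|apply clip_val, proj2_sig]. Qed.

Lemma PI_scale (t : R) : 0 <= t <= 1 -> 0 <= PI * t <= PI.
Proof.
  intros H; pose proof PI_RGT_0; split; [apply Rmult_le_pos; lra|].
  rewrite <- (Rmult_1_r PI) at 2; apply Rmult_le_compat_l; lra.
Qed.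

Lemma PI_unscale (x : I0pi) : 0 <= proj1_sig x / PI <= 1.
Proof.
  destruct x as [x Hx]; simpl; pose proof PI_RGT_0; split.
  - apply Rdiv_le_0_compat; lra.
  - apply (Rmult_le_reg_r PI); [lra|]; unfold Rdiv; rewrite Rmult_assoc, Rinv_l; lra.
Qed.

(** Domain and values are both divided by [PI], which keeps the Lipschitz constant 1. *)
Definition profile (f : Fspace) (t : R) : R := proj1_sig f (clip (PI * t)) / PI.

Lemma profile_lipschitz (f : Fspace) : lipschitz1 (profile f).
Proof.
  intros s t Hs Ht; destruct f as [f Hf]; unfold profile; simpl; pose proof PI_RGT_0.
  assert (H1 := proj1 Hf (clip (PI * t)) (clip (PI * s))).
  rewrite !clip_val in H1 by (apply PI_scale; lra).
  rewrite <- Rmult_minus_distr_l, Rabs_mult, (Rabs_pos_eq PI),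
    (Rabs_pos_eq (t - s)) in H1 by lra.
  replace (f (clip (PI * t)) / PI - f (clip (PI * s)) / PI)
    with ((f (clip (PI * t)) - f (clip (PI * s))) * / PI) by (field; lra).
  rewrite Rabs_mult, (Rabs_pos_eq (/ PI)) by (apply Rlt_le, Rinv_0_lt_compat; lra).
  apply (Rmult_le_reg_r PI); [easy|].
  rewrite Rmult_assoc, Rinv_l by lra; lra.
Qed.

Lemma profile_ends (f : Fspace) : profile f 0 + profile f 1 = 1.
Proof.
  destruct f as [f Hf]; unfold profile; simpl; pose proof PI_RGT_0.
  assert (H1 := proj2 (proj2 Hf) (clip (PI * 0)) (clip (PI * 1))).
  rewrite !clip_val in H1 by (apply PI_scale; lra).
  specialize (H1 ltac:(ring) ltac:(ring)).
  apply (Rmult_eq_reg_r PI); [|lra]; field_simplify; lra.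
Qed.

(* [PI * (1 - m xH) / 2] is the value at [0] forced by [f(0) + f(pi) = pi]. *)
Definition build (m : positive -> R) (x : I0pi) : R :=
  PI * ((1 - m xH) / 2 + primitive m xH (proj1_sig x / PI)).

Lemma primitive_lipschitz_abs (m : positive -> R) (s t : R) :
  consistent mean m -> bounded m -> 0 <= s <= 1 -> 0 <= t <= 1 ->
  Rabs (primitive m xH s - primitive m xH t) <= Rabs (s - t).
Proof.
  intros Hm Bm Hs Ht; destruct (Rle_dec s t).
  - rewrite Rabs_minus_sym, (Rabs_minus_sym s), (Rabs_pos_eq (t - s)) by lra.
    apply primitive_lipschitz; easy || lra.
  - rewrite (Rabs_pos_eq (s - t)) by lra; apply primitive_lipschitz; easy || lra.
Qed.

Lemma build_inF (m : positive -> R) : consistent mean m -> bounded m -> inF (build m).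
Proof.
  intros Hm Bm; pose proof PI_RGT_0; unfold build; split; [|split].
  - intros x y.
    match goal with |- Rabs ?z <= _ => replace z with (PI *
      (primitive m xH (proj1_sig x / PI) - primitive m xH (proj1_sig y / PI))) by ring end.
    rewrite Rabs_mult, (Rabs_pos_eq PI) by lra.
    apply Rle_trans with (PI * Rabs (proj1_sig x / PI - proj1_sig y / PI)).
    + apply Rmult_le_compat_l; [lra|].
      apply primitive_lipschitz_abs; try apply PI_unscale; easy.
    + rewrite <- (Rabs_pos_eq PI) at 1 by lra; rewrite <- Rabs_mult.
      right; f_equal; field; lra.
  (* With [P = primitive m xH t], the value is [(1 - (m xH - P) + P) / 2], and
     [Rabs (m xH - P) + Rabs P <= (1 - t) + t]. *)
  - intros x; apply PI_scale; pose proof (PI_unscale x) as Hx.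
    revert Hx; generalize (proj1_sig x / PI); intros t Ht.
    assert (H0 := primitive_lipschitz m Hm Bm xH 0 t ltac:(lra) ltac:(lra)).
    assert (H1 := primitive_lipschitz m Hm Bm xH t 1 ltac:(lra) ltac:(lra)).
    rewrite primitive_0 in H0; rewrite primitive_1 in H1 by easy.
    revert Ht H0 H1; clear; intros; split_flat.
  - intros x y -> ->; rewrite Rdiv_0_l, primitive_0, Rdiv_diag, primitive_1 by (easy || lra).
    field.
Qed.

(** The slopes determine the profile up to a constant, and the condition at the two ends fixes the
    constant. *)
Lemma build_slope (f : Fspace) : build (slope (profile f)) = proj1_sig f.
Proof.
  apply functional_extensionality; intros x; unfold build; pose proof PI_RGT_0.
  rewrite primitive_slope by (apply profile_lipschitz || apply PI_unscale).
  unfold slope, rescale; simpl; rewrite !Rplus_0_l, Rmult_1_r.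
  pose proof (profile_ends f) as E.
  replace (profile f 1) with (1 - profile f 0) by lra.
  transitivity (PI * profile f (proj1_sig x / PI)); [field|].
  unfold profile; replace (PI * (proj1_sig x / PI)) with (proj1_sig x) by (field; lra).
  rewrite clip_id; field; lra.
Qed.

Lemma slope_build (m : positive -> R) (H : inF (build m)) :
  consistent mean m -> bounded m -> slope (profile (exist _ (build m) H)) = m.
Proof.
  intros Hm Bm; rewrite <- (slope_primitive m Hm Bm) at 2.
  apply (slope_ext _ _ ((1 - m xH) / 2)); intros t Ht; pose proof PI_RGT_0.
  unfold profile, build; cbn [proj1_sig]; rewrite clip_val by now apply PI_scale.
  replace (PI * t / PI) with t by (field; lra). field; lra.
Qed.

(** [real] is faithful only on finite values: the bound [c] excludes [p_infty], and the point
    [clip 0] excludes [m_infty]. *)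
Lemma dF_lub (f g : Fspace) (c : R) :
  (forall x, Rabs (proj1_sig f x - proj1_sig g x) <= c) ->
  (forall x, Rabs (proj1_sig f x - proj1_sig g x) <= dF f g) /\ dF f g <= c.
Proof.
  intros Hc; unfold dF.
  match goal with |- context [Lub_Rbar ?E] => destruct (Lub_Rbar_correct E) as [H1 H2];
    destruct (Lub_Rbar E) as [l| |] end.
  - split.
    + intros x; apply (H1 (Rabs (proj1_sig f x - proj1_sig g x))); now exists x.
    + apply (H2 c); intros r [x ->]; apply Hc.
  - exfalso; apply (H2 c); intros r [x ->]; apply Hc.
  - exfalso; apply (H1 (Rabs (proj1_sig f (clip 0) - proj1_sig g (clip 0)))).
    now exists (clip 0).
Qed.

Lemma dF_upper (f g : Fspace) (x : I0pi) :
  Rabs (proj1_sig f x - proj1_sig g x) <= dF f g.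
Proof.
  apply (dF_lub f g PI); intros y.
  pose proof (proj1 (proj2 (proj2_sig f)) y); pose proof (proj1 (proj2 (proj2_sig g)) y).
  apply Rabs_le; lra.
Qed.

Lemma contin_eval (a : Fspace) (x : I0pi) : contin dF a (fun f => proj1_sig f x).
Proof.
  apply contin_spec; intros eps He; exists eps; split; [easy|].
  intros b Hb; rewrite Rabs_minus_sym; eapply Rle_lt_trans; [apply dF_upper|easy].
Qed.

Lemma contin_slope (a : Fspace) (p : positive) :
  contin dF a (fun f => slope (profile f) p).
Proof.
  pose proof (node_bounds p); pose proof PI_RGT_0.
  assert (forall t, contin dF a (fun f => profile f t)).
  { intros t; apply contin_div; [lra|apply contin_eval|apply contin_const]. }
  apply contin_div; [lra|now apply contin_minus|apply contin_const].
Qed.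

Lemma metric_continuous_build {X : Type} (d : X -> X -> R) (m : X -> positive -> R)
  (h : X -> Fspace) :
  (forall b, consistent mean (m b)) -> (forall b, bounded (m b)) ->
  (forall a p, contin d a (fun b => m b p)) ->
  (forall b, proj1_sig (h b) = build (m b)) -> metric_continuous d dF h.
Proof.
  intros Hm Bm Cm Hh a eps He; pose proof PI_RGT_0.
  assert (Hk : 0 < eps / (4 * PI)) by (apply Rdiv_lt_0_compat; lra).
  pose proof (primitive_near d a m xH _ Hm Bm (Cm a) Hk) as N1.
  pose proof (proj1 (contin_spec _ _ _) (Cm a xH) _ Hk) as N2.
  destruct (filter_and _ _ N1 N2) as [delta [Hd HN]].
  exists delta; split; [easy|]; intros b Hb.
  destruct (HN b Hb) as [K1 K2].
  (* A supremum inherits only a weak inequality, so half of [eps] is kept in reserve. *)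
  apply Rle_lt_trans with (eps / 2); [|lra].
  apply dF_lub; intros x; rewrite !Hh; unfold build.
  assert (K := K1 _ (PI_unscale x)); revert K K2.
  generalize (primitive (m b) xH (proj1_sig x / PI)) (primitive (m a) xH (proj1_sig x / PI))
    (m b xH) (m a xH); intros y y' z z' K K2.
  rewrite <- Rmult_minus_distr_l, Rabs_mult, (Rabs_pos_eq PI) by lra.
  replace (eps / 2) with (PI * (2 * (eps / (4 * PI)))) by (field; lra).
  apply Rmult_le_compat_l; [lra|].
  revert K K2 Hk; generalize (eps / (4 * PI)); clear; intros; split_flat.
Qed.

(** * The Hilbert cube *)

Lemma is_series_telescope : is_series (fun n => / INR (S n) - / INR (S (S n))) 1.
Proof.
  apply (is_lim_seq_ext (fun n => 1 - / INR (S (S n))) _ (Finite 1)).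
  - intros n; induction n as [|n IH].
    + rewrite sum_O; simpl; field.
    + rewrite sum_Sn, <- IH; unfold plus; simpl; ring.
  - replace (Finite 1) with (Finite (1 - 0)) by (f_equal; ring).
    apply (is_lim_seq_minus' (fun _ => 1) _ 1 0); [apply is_lim_seq_const|].
    apply (is_lim_seq_incr_1 (fun n => / INR (S n))).
    apply (is_lim_seq_incr_1 (fun n => / INR n)).
    replace (Finite 0) with (Rbar_inv p_infty) by easy.
    apply is_lim_seq_inv; [apply is_lim_seq_INR|easy].
Qed.

(** Comparison with twice the telescoping series: [1 / (n+1)^2 <= 2 / ((n+1) (n+2))]. *)
Lemma ex_series_inv_sq : ex_series (fun n => (/ INR (S n)) ^ 2).
Proof.
  apply (@ex_series_le R_AbsRing R_CompleteNormedModule _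
    (fun n => 2 * (/ INR (S n) - / INR (S (S n))))).
  - intros n; match goal with |- norm ?z <= _ => change (norm z) with (Rabs z) end.
    rewrite Rabs_pos_eq by (apply pow_le, Rlt_le, Rinv_0_lt_compat, lt_0_INR; lia).
    rewrite (S_INR (S n)); pose proof (pos_INR n) as Hn; rewrite S_INR.
    revert Hn; generalize (INR n); intros x Hx.
    apply Rminus_le_0.
    match goal with |- 0 <= ?z =>
      replace z with (x / ((x + 1) ^ 2 * (x + 1 + 1))) by (field; lra) end.
    apply Rdiv_le_0_compat; [easy|].
    apply Rmult_lt_0_compat; [apply pow_lt|]; lra.
  - apply (ex_series_scal 2 (fun n => / INR (S n) - / INR (S (S n)))).
    exists 1; apply is_series_telescope.
Qed.

Lemma dH_terms (x y : Hcube) (n : nat) :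
  0 <= (proj1_sig x n - proj1_sig y n) ^ 2 <= 4 * (/ INR (S n)) ^ 2.
Proof.
  split; [apply pow2_ge_0|].
  replace (4 * (/ INR (S n)) ^ 2) with ((2 * / INR (S n)) ^ 2) by ring.
  apply pow_maj_Rabs.
  pose proof (proj2_sig x n) as Hx; pose proof (proj2_sig y n) as Hy; simpl in Hx, Hy.
  eapply Rle_trans; [apply Rabs_triang|]; rewrite Rabs_Ropp; simpl in *; lra.
Qed.

Lemma ex_series_dH (x y : Hcube) :
  ex_series (fun n => (proj1_sig x n - proj1_sig y n) ^ 2).
Proof.
  apply (@ex_series_le R_AbsRing R_CompleteNormedModule _
    (fun n => 4 * (/ INR (S n)) ^ 2)).
  - intros n; match goal with |- norm ?z <= _ => change (norm z) with (Rabs z) end.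
    rewrite Rabs_pos_eq; apply (dH_terms x y n).
  - apply (ex_series_scal 4 (fun n => (/ INR (S n)) ^ 2)), ex_series_inv_sq.
Qed.

Lemma partial_sum_le_Series (a : nat -> R) (N : nat) :
  (forall n, 0 <= a n) -> ex_series a -> sum_n a N <= Series a.
Proof.
  intros Ha Ea.
  apply (is_lim_seq_incr_compare (sum_n a) (Series a)).
  - exact (Series_correct a Ea).
  - intros n; rewrite sum_Sn; specialize (Ha (S n)); unfold plus; simpl; lra.
Qed.

Lemma term_le_Series (a : nat -> R) (N : nat) :
  (forall n, 0 <= a n) -> ex_series a -> a N <= Series a.
Proof.
  intros Ha Ea; eapply Rle_trans; [|now apply (partial_sum_le_Series a N)].
  assert (P : forall k, 0 <= sum_n a k).
  { intros k; induction k as [|k IH]; [rewrite sum_O; apply Ha|].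
    rewrite sum_Sn; specialize (Ha (S k)); unfold plus; simpl; lra. }
  destruct N as [|N]; [rewrite sum_O; lra|].
  rewrite sum_Sn; specialize (P N); unfold plus; simpl; lra.
Qed.

Lemma dH_upper (x y : Hcube) (n : nat) : Rabs (proj1_sig x n - proj1_sig y n) <= dH x y.
Proof.
  rewrite <- sqrt_Rsqr_abs; apply sqrt_le_1_alt; rewrite Rsqr_pow2.
  apply (term_le_Series (fun n => (proj1_sig x n - proj1_sig y n) ^ 2));
    [intros k; apply pow2_ge_0|apply ex_series_dH].
Qed.

Lemma contin_coordinate (a : Hcube) (n : nat) : contin dH a (fun x => proj1_sig x n).
Proof.
  apply contin_spec; intros eps He; exists eps; split; [easy|].
  intros b Hb; rewrite Rabs_minus_sym; eapply Rle_lt_trans; [apply dH_upper|easy].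
Qed.

(** All tails are dominated by those of the single convergent series [B], so one [N] serves every
    pair of points. This uniformity makes the metric topology of the cube the product topology. *)
Lemma dH_tail (eps : R) : 0 < eps -> exists N, forall x y : Hcube,
  (dH x y) ^ 2 <= sum_n (fun n => (proj1_sig x n - proj1_sig y n) ^ 2) N + eps.
Proof.
  intros He; set (B := fun n => 4 * (/ INR (S n)) ^ 2).
  assert (EB : ex_series B)
    by apply (ex_series_scal 4 (fun n => (/ INR (S n)) ^ 2)), ex_series_inv_sq.
  assert (L : is_lim_seq (sum_n B) (Series B)) by exact (Series_correct B EB).
  apply is_lim_seq_spec in L; destruct (L (mkposreal eps He)) as [N HN]; exists N.
  specialize (HN N (le_n N)); simpl in HN.
  intros x y; set (a := fun n => (proj1_sig x n - proj1_sig y n) ^ 2).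
  assert (Ea : ex_series a) by apply ex_series_dH.
  assert (Ha : forall n, 0 <= a n <= B n) by (intros n; apply dH_terms).
  assert (E : (dH x y) ^ 2 = Series a).
  { unfold dH; apply pow2_sqrt.
    eapply Rle_trans; [apply (Ha O)|apply term_le_Series; [apply Ha|easy]]. }
  (* [sum_n a N] has [S N] terms, so the series is split at [S N]. *)
  rewrite E, (Series_incr_n a (S N)), <- sum_n_Reals by (easy || lia); simpl pred.
  rewrite (Series_incr_n B (S N)), <- sum_n_Reals in HN by (easy || lia); simpl pred in HN.
  assert (T : Series (fun k => a (S N + k)%nat) <= Series (fun k => B (S N + k)%nat)).
  { apply Series_le; [intros n; apply Ha|now apply ex_series_incr_n]. }
  apply Rabs_lt_between in HN; lra.
Qed.

(** Of the budget [eps ^ 2] for the squared distance, half pays for the uniform tail and half for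
    the finite sum, which is continuous in [b] and vanishes at [a]. *)
Lemma metric_continuous_cube {X : Type} (d : X -> X -> R) (h : X -> Hcube) :
  (forall a n, contin d a (fun b => proj1_sig (h b) n)) -> metric_continuous d dH h.
Proof.
  intros Hh a eps He.
  destruct (dH_tail (eps ^ 2 / 2)) as [N HN].
  { assert (0 < eps ^ 2) by (apply pow_lt; lra); lra. }
  assert (S0 : forall x : Hcube,
    sum_n (fun n => (proj1_sig x n - proj1_sig x n) ^ 2) N = 0).
  { intros x; rewrite (sum_n_ext _ (fun _ => 0))
      by (intros n; rewrite Rminus_diag; apply Rmult_0_l).
    rewrite sum_n_const; apply Rmult_0_r. }
  assert (Ct : contin d a
    (fun b => sum_n (fun n => (proj1_sig (h a) n - proj1_sig (h b) n) ^ 2) N)).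
  { clear HN S0.
    assert (T : forall n, contin d a (fun b => (proj1_sig (h a) n - proj1_sig (h b) n) ^ 2)).
    { intros n; assert (contin d a (fun b => proj1_sig (h a) n - proj1_sig (h b) n))
        by (apply contin_minus; [apply contin_const|apply Hh]).
      simpl; apply contin_mult; [easy|apply contin_mult; [easy|apply contin_const]]. }
    induction N as [|N IH].
    - apply (contin_ext d a _ _ (fun b => eq_sym (sum_O _))), T.
    - apply (contin_ext d a _ _ (fun b => eq_sym (sum_Sn _ _))).
      apply (contin_plus d a _ _ IH (T (S N))). }
  destruct (proj1 (contin_spec _ _ _) Ct (eps ^ 2 / 2)) as [delta [Hd HD]].
  { assert (0 < eps ^ 2) by (apply pow_lt; lra); lra. }
  exists delta; split; [easy|]; intros b Hb; specialize (HD b Hb).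
  rewrite S0, Rminus_0_r in HD; specialize (HN (h a) (h b)).
  apply Rabs_lt_between in HD.
  apply Rnot_le_lt; intros G.
  assert (eps ^ 2 <= dH (h a) (h b) ^ 2) by (apply pow_incr; lra); lra.
Qed.

(** * The homeomorphism and its inverse *)

Definition shrink (x : nat -> R) (n : nat) : R := x n / INR (S n).
Definition stretch (y : nat -> R) (n : nat) : R := y n * INR (S n).

Lemma INR_S_pos (n : nat) : 0 < INR (S n).
Proof. apply lt_0_INR; lia. Qed.

Lemma shrink_inH (x : nat -> R) : (forall n, Rabs (x n) <= 1) -> inH (shrink x).
Proof.
  intros Hx n; pose proof (INR_S_pos n); pose proof (Rinv_0_lt_compat _ H).
  unfold shrink, Rdiv; rewrite Rabs_mult, (Rabs_pos_eq (/ _)) by lra.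
  rewrite <- (Rmult_1_l (/ _)) at 2; apply Rmult_le_compat_r; [lra|apply Hx].
Qed.

Lemma stretch_bounded (y : Hcube) (n : nat) : Rabs (stretch (proj1_sig y) n) <= 1.
Proof.
  pose proof (INR_S_pos n); pose proof (proj2_sig y n) as Hy.
  unfold stretch; rewrite Rabs_mult, (Rabs_pos_eq (INR _)) by lra.
  apply (Rmult_le_compat_r (INR (S n))) in Hy; [|lra].
  now rewrite Rinv_l in Hy by lra.
Qed.

Lemma stretch_shrink (x : nat -> R) : stretch (shrink x) = x.
Proof.
  apply functional_extensionality; intros n; pose proof (INR_S_pos n).
  unfold stretch, shrink; field; lra.
Qed.

Lemma shrink_stretch (y : nat -> R) : shrink (stretch y) = y.
Proof.
  apply functional_extensionality; intros n; pose proof (INR_S_pos n).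
  unfold stretch, shrink; field; lra.
Qed.

Definition bent_slopes (f : Fspace) : positive -> R := transfer bend (slope (profile f)).

Definition straight_slopes (y : Hcube) : positive -> R :=
  transfer mean (decode (stretch (proj1_sig y))).

Lemma bent_slopes_bounded (f : Fspace) : bounded (bent_slopes f).
Proof.
  apply (transfer_bounded bend mean); [apply bend_lipschitz2|apply bend_preserves_bounds|
    apply bend_close|apply slope_consistent|apply slope_bounded, profile_lipschitz].
Qed.

Lemma bent_slopes_consistent (f : Fspace) : consistent bend (bent_slopes f).
Proof.
  apply (transfer_consistent bend mean); [apply bend_lipschitz2|
    apply bend_close|apply slope_consistent|apply slope_bounded, profile_lipschitz].
Qed.

Lemma straight_slopes_bounded (y : Hcube) : bounded (straight_slopes y).
Proof.
  apply (transfer_bounded mean bend); [apply mean_lipschitz2|apply mean_preserves_bounds|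
    apply mean_close|apply decode_consistent|apply decode_bounded]; apply stretch_bounded.
Qed.

Lemma straight_slopes_consistent (y : Hcube) : consistent mean (straight_slopes y).
Proof.
  apply (transfer_consistent mean bend); [apply mean_lipschitz2|
    apply mean_close|apply decode_consistent|apply decode_bounded]; apply stretch_bounded.
Qed.

Definition to_cube (f : Fspace) : Hcube :=
  exist _ (shrink (code (bent_slopes f)))
    (shrink_inH _ (fun n => code_bounded _ n (bent_slopes_bounded f))).

Definition of_cube (y : Hcube) : Fspace :=
  exist _ (build (straight_slopes y))
    (build_inF _ (straight_slopes_consistent y) (straight_slopes_bounded y)).

Lemma of_cube_to_cube (f : Fspace) : of_cube (to_cube f) = f.
Proof.
  apply eq_sig_hprop; [intros; apply proof_irrelevance|].
  unfold of_cube, to_cube, straight_slopes; cbn [proj1_sig].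
  rewrite stretch_shrink, decode_code
    by (apply bent_slopes_consistent || apply bent_slopes_bounded).
  unfold bent_slopes; rewrite transfer_cancel; [apply build_slope|
    apply bend_lipschitz2|apply mean_lipschitz2|apply bend_close|
    apply slope_consistent|apply slope_bounded, profile_lipschitz].
Qed.

Lemma to_cube_of_cube (y : Hcube) : to_cube (of_cube y) = y.
Proof.
  apply eq_sig_hprop; [intros; apply proof_irrelevance|].
  unfold to_cube, of_cube, bent_slopes; cbn [proj1_sig].
  rewrite slope_build
    by (apply straight_slopes_consistent || apply straight_slopes_bounded).
  unfold straight_slopes; rewrite transfer_cancel;
    [|apply mean_lipschitz2|apply bend_lipschitz2|apply mean_close|
     apply decode_consistent; apply stretch_bounded|
     apply decode_bounded; apply stretch_bounded].
  rewrite code_decode by apply stretch_bounded; apply shrink_stretch.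
Qed.

Lemma to_cube_continuous : metric_continuous dF dH to_cube.
Proof.
  apply metric_continuous_cube; intros a n; simpl.
  apply contin_div; [apply not_0_INR; lia| |apply contin_const].
  apply contin_code; [apply bent_slopes_bounded|].
  apply (transfer_contin bend mean bend_lipschitz2 bend_close).
  - intros p f g; apply contin_bend.
  - intros b; apply slope_consistent.
  - intros b; apply slope_bounded, profile_lipschitz.
  - apply contin_slope.
Qed.

Lemma of_cube_continuous : metric_continuous dH dF of_cube.
Proof.
  apply (metric_continuous_build dH straight_slopes);
    [apply straight_slopes_consistent|apply straight_slopes_bounded| |easy].
  intros a; apply (transfer_contin mean bend mean_lipschitz2 mean_close).
  - intros p f g; apply contin_mean.
  - intros b; apply decode_consistent, stretch_bounded.
  - intros b; apply decode_bounded, stretch_bounded.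
  - intros p; apply contin_decode; intros n.
    apply contin_mult; [apply contin_coordinate|apply contin_const].
Qed.

Theorem theorem3p10 : homeomorphic dF dH.
Proof.
  exists to_cube, of_cube; split; [exact of_cube_to_cube|].
  split; [exact to_cube_of_cube|].
  split; [exact to_cube_continuous|exact of_cube_continuous].
Qed.
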